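(* Let $F_2=F(\{a,b\})$ be the free group on $\{a,b\}$, and let $H, K\leqslant F_2$ be two finitely generated subgroups. If at least one of $H$, $K$ is source/sink-free (with respect to the basis $\{a,b\}$), then the pair $(H,K)$ satisfies the Hanna Neumann conjecture, i.e. $$\mathrm{rank}(H\cap K)-1\;\leqslant\;[\mathrm{rank}(H)-1]\,[\mathrm{rank}(K)-1].$$
   Context: For a finitely generated subgroup $H$ of a free group $F(X)$, the folding $\Gamma_H=(V_H,E_H)$ is the (Stallings) directed multigraph, loops allowed, with a distinguished vertex $1_H$ and with each directed edge labeled by an element of $X$, obtained as follows: take a finite set of freely reduced words generating $H$, form the rose consisting of one closed path at $1_H$ for each generator, labeled by the successive letters of that generator (a letter $x^{-1}$ corresponds to traversing an edge labeled $x$ backwards), and repeatedly identify pairs of edges that have the same label and the same head, or the same label and the same tail, until no such pair remains. Up to isomorphism the result depends only on $H$; it is a finite connected graph in which distinct edges with the same label have distinct heads and distinct tails, and the set of freely reduced elements of $H$ is the set of words read along closed non-backtracking walks starting and ending at $1_H$ (edges may be traversed in either direction). The degree of a vertex is the sum of its in-degree and out-degree. A vertex $v$ of $\Gamma_H$ is a source [resp. sink] if it has degree $2$ in $\Gamma_H$ and is incident to exactly two outgoing [resp. incoming] edges (so that $v$ by itself forms a strongly connected component). A finitely generated $H\leqslant F(X)$ is source/sink-free (with respect to $X$) if $\Gamma_H$ contains neither source nor sink vertices. The rank of a free group is the cardinality of a basis. The Hanna Neumann conjecture states that the displayed inequality holds for all finitely generated subgroups $H,K$ of a free group $F$.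
   Formalization: H and K are assumed nontrivial: for H trivial (source/sink-free) and K of rank 3 the displayed inequality would read -1 ≤ -2, which is false. *)

(* Defs.v *)
From HB Require Import structures.
From Stdlib Require Import Relations.
From mathcomp Require Import all_boot.

Set Implicit Arguments.
Unset Strict Implicit.
Unset Printing Implicit Defensive.

(* A letter is a generator together with a sign: (x, true) stands for x and
   (x, false) for x^-1. *)
Definition letter (X : Type) : Type := (X * bool)%type.

Definition linv (X : Type) (l : letter X) : letter X := (l.1, ~~ l.2).

Definition reduced (X : eqType) (w : seq (letter X)) : bool :=
  sorted (fun l m => m != linv l) w.

(* The free group F(X): freely reduced words, multiplied by concatenation
   followed by free reduction. *)
Record freeGroup (X : choiceType) : Type :=
  FreeGroup { word :> seq (letter X); word_reduced : reduced word }.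

Section FreeGroupTheory.
Variable X : choiceType.
Implicit Types (l m : letter X) (u v w : seq (letter X)).

HB.instance Definition _ := [isSub of freeGroup X for @word X].
HB.instance Definition _ := [Choice of freeGroup X by <:].

Definition push l w : seq (letter X) :=
  if w is m :: w' then if m == linv l then w' else l :: w else [:: l].

Definition wmul u v : seq (letter X) := foldr push v u.

Definition winv u : seq (letter X) := rev [seq linv l | l <- u].

Lemma linvK : involutive (@linv X).
Proof. by move=> [x b]; rewrite /linv /= negbK. Qed.

Lemma push_reduced l w : reduced w -> reduced (push l w).
Proof.
case: w => [|m w] //= Hw; case: ifP => [_|E].
  exact: (path_sorted Hw).
by rewrite /reduced /= E.
Qed.

Lemma wmul_reduced u v : reduced v -> reduced (wmul u v).
Proof. by move=> Hv; elim: u => //= l u IHu; apply: push_reduced. Qed.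

Lemma pushK l w : reduced w -> push l (push (linv l) w) = w.
Proof.
case: w => [|m w] /=; first by rewrite eqxx.
rewrite linvK; case: eqP => [->|_] Hw; last by rewrite /= eqxx.
by case: w Hw => [|m' w] //= /andP[/negbTE -> _].
Qed.

Lemma wmul_push l t w :
  reduced w -> wmul (push l t) w = push l (wmul t w).
Proof.
case: t => [|m t] //= Hw; case: eqP => //= ->.
by rewrite pushK // wmul_reduced.
Qed.

Lemma wmulA u v w : reduced w -> wmul u (wmul v w) = wmul (wmul u v) w.
Proof. by move=> Hw; elim: u => //= l u ->; rewrite wmul_push. Qed.

Lemma wmulw1 u : reduced u -> wmul u [::] = u.
Proof.
elim: u => //= l u IHu Hu; rewrite IHu; last exact: path_sorted Hu.
by case: u Hu {IHu} => //= m u /andP[/negbTE -> _].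
Qed.

Lemma wmulVw u : wmul (winv u) u = [::].
Proof.
elim: u => //= l u IHu.
by rewrite /winv /= rev_cons /wmul foldr_rcons /= linvK eqxx.
Qed.

Lemma winvK : involutive winv.
Proof. by move=> u; rewrite /winv map_rev revK (mapK linvK). Qed.

Lemma winv_reduced u : reduced u -> reduced (winv u).
Proof.
rewrite /reduced /winv rev_sorted sorted_map => /=.
by apply: sub_sorted => l m /=; rewrite linvK eq_sym.
Qed.

Definition fgone : freeGroup X := @FreeGroup X [::] isT.
Definition fgmul (u v : freeGroup X) : freeGroup X :=
  FreeGroup (wmul_reduced u (word_reduced v)).
Definition fginv (u : freeGroup X) : freeGroup X :=
  FreeGroup (winv_reduced (word_reduced u)).

Fact fgmulA : associative fgmul.
Proof. by move=> u v w; apply/val_inj/wmulA/word_reduced. Qed.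
Fact fgmul1 : left_id fgone fgmul.
Proof. by move=> u; apply/val_inj. Qed.
Fact fgmulr1 : right_id fgone fgmul.
Proof. by move=> u; apply/val_inj/wmulw1/word_reduced. Qed.
Fact fgmulV : left_inverse fgone fginv fgmul.
Proof. by move=> u; apply/val_inj/wmulVw. Qed.
Fact fgmulrV : right_inverse fgone fginv fgmul.
Proof. by move=> u; apply/val_inj; rewrite /= -{1}[word u]winvK wmulVw. Qed.

HB.instance Definition _ :=
  isGroup.Build (freeGroup X) fgmulA fgmul1 fgmulr1 fgmulV fgmulrV.

End FreeGroupTheory.

Local Open Scope group_scope.

Section Subgroups.
Variable G : groupType.
Implicit Types (H K : G -> Prop).

Definition is_subgroup H : Prop :=
  [/\ H 1, forall x y, H x -> H y -> H (x * y) & forall x, H x -> H x^-1].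

Definition nontrivial H : Prop := exists2 x, H x & x <> 1.

Definition subgroupI H K : G -> Prop := fun x => H x /\ K x.

Definition generated (S : seq G) : G -> Prop :=
  fun x => forall H, is_subgroup H -> (forall s, s \in S -> H s) -> H x.

Definition generates (S : seq G) H : Prop := forall x, H x <-> generated S x.

Definition finitely_generated H : Prop := exists S : seq G, generates S H.

(* The value at u of the homomorphism F(Y) -> G that maps each y to g y. *)
Definition free_lift (Y : choiceType) (g : Y -> G) (u : freeGroup Y) : G :=
  \prod_(l <- word u) (if l.2 then g l.1 else (g l.1)^-1).

Definition is_basis (n : nat) (g : 'I_n -> G) H : Prop :=
  injective (free_lift g) /\ (forall x, H x <-> exists u, x = free_lift g u).

Definition has_rank H (n : nat) : Prop := exists g : 'I_n -> G, is_basis g H.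

End Subgroups.

Section Foldings.
Variable X : choiceType.

Record lgraph : Type := LGraph {
  vertex : finType;
  edge : finType;
  src : edge -> vertex;
  tgt : edge -> vertex;
  lab : edge -> X;
  base : vertex }.

(* The rose of a list S of words.  The k-th point (0 <= k <= size w) of the
   petal of w = tnth (in_tuple S) i is the base vertex None if k = 0 or
   k = size w; each petal of length m >= 1 has m - 1 further vertices. *)
Section Rose.
Variable S : seq (freeGroup X).
Definition petal (i : 'I_(size S)) : seq (letter X) :=
  word (tnth (in_tuple S) i).

Definition rose_vertex : finType :=
  option {i : 'I_(size S) & 'I_(size (petal i)).-1}.

Definition rose_edge : finType := {i : 'I_(size S) & 'I_(size (petal i))}.

Definition rose_point (i : 'I_(size S)) (k : nat) : rose_vertex :=
  if k is k'.+1 then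
    if (insub k' : option 'I_(size (petal i)).-1) is Some j
    then Some (Tagged (fun i => 'I_(size (petal i)).-1) j) else None
  else None.

Definition rose_letter (e : rose_edge) : letter X :=
  tnth (in_tuple (petal (tag e))) (tagged e).

Definition rose_src (e : rose_edge) : rose_vertex :=
  if (rose_letter e).2 then rose_point (tag e) (tagged e)
  else rose_point (tag e) (tagged e).+1.

Definition rose_tgt (e : rose_edge) : rose_vertex :=
  if (rose_letter e).2 then rose_point (tag e) (tagged e).+1
  else rose_point (tag e) (tagged e).

Definition rose : lgraph :=
  @LGraph rose_vertex rose_edge rose_src rose_tgt
          (fun e => (rose_letter e).1) None.
End Rose.

Definition foldable (A : lgraph) (e1 e2 : edge A) : Prop :=
  [/\ e1 <> e2, lab e1 = lab e2 & src e1 = src e2 \/ tgt e1 = tgt e2].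

Definition glue (T : Type) (x y : T) (s t : T) : Prop :=
  [\/ s = t, s = x /\ t = y | s = y /\ t = x].

(* B is, up to isomorphism, the quotient of A obtained by identifying the
   foldable edges e1 and e2: fV and fE are the quotient maps.  As e1 and e2
   share an end, at most one pair of distinct vertices is identified. *)
Definition fold_step (A B : lgraph) : Prop :=
  exists (e1 e2 : edge A) (fV : vertex A -> vertex B) (fE : edge A -> edge B),
  [/\ foldable e1 e2,
      [/\ forall e, src (fE e) = fV (src e),
          forall e, tgt (fE e) = fV (tgt e),
          forall e, lab (fE e) = lab e &
          fV (base A) = base B],
      (forall b, exists a, fV a = b) /\ (forall b, exists a, fE a = b),
      forall e e', fE e = fE e' <-> glue e1 e2 e e' &
      forall v v', fV v = fV v' <->
        glue (src e1) (src e2) v v' \/ glue (tgt e1) (tgt e2) v v'].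

Definition folded (A : lgraph) : Prop :=
  forall e1 e2 : edge A, ~ foldable e1 e2.

Definition is_folding (H : freeGroup X -> Prop) (A : lgraph) : Prop :=
  exists S : seq (freeGroup X),
    [/\ generates S H, clos_refl_trans lgraph fold_step (rose S) A & folded A].

Definition outdeg (A : lgraph) (v : vertex A) : nat := #|[set e | src e == v]|.
Definition indeg (A : lgraph) (v : vertex A) : nat := #|[set e | tgt e == v]|.
Definition degree (A : lgraph) (v : vertex A) : nat := indeg v + outdeg v.

Definition is_source (A : lgraph) (v : vertex A) : Prop :=
  degree v = 2 /\ outdeg v = 2.

Definition is_sink (A : lgraph) (v : vertex A) : Prop :=
  degree v = 2 /\ indeg v = 2.

(* The folding is unique up to isomorphism, so quantifying existentially over
   it is the same as quantifying universally. *)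
Definition source_sink_free (H : freeGroup X -> Prop) : Prop :=
  exists2 A : lgraph, is_folding H A &
    forall v : vertex A, ~ is_source v /\ ~ is_sink v.

End Foldings.

(* Main.v *)
(* Stallings: if A is a finite connected folded graph then the group read along
   its closed walks at the base point has rank |E_A| - |V_A| + 1, and H /\ K is
   read in the component D of the base point of the pullback of graphs A, B for
   H, K.  So one has to show |E_D| - |V_D| <= (|E_A| - |V_A|) (|E_B| - |V_B|).

   If A is the folding of a source/sink-free H, then, up to reversing all edges,
   every vertex of A has out-degree 1 or 2, so |E_A| - |V_A| is the number of
   vertices of out-degree 2.  As B is connected and not a tree, each vertex of B
   can choose an incident edge, injectively; take such a choice with as many
   outgoing edges as possible, so that the source of an edge which is not chosen
   always chooses an outgoing edge.  The |E_B| - |V_B| edges not chosen and the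
   vertices of out-degree 2 of A account for (|E_A| - |V_A|) (|E_B| - |V_B|)
   edges of the pullback, and the remaining edges of D inject into its vertices:
   see [pullback_bound]. *)
From Stdlib Require Import Relations ClassicalEpsilon.
Require Import Defs.
From mathcomp Require Import all_boot all_order all_algebra.
From mathcomp Require Import zify.

Set Implicit Arguments.
Unset Strict Implicit.
Unset Printing Implicit Defensive.

Import GRing.Theory.
Local Open Scope group_scope.

(** * Free groups and uniqueness of rank *)

Section FreeGroups.
Variable X : choiceType.
Implicit Types (p q : seq (letter X)) (u v : freeGroup X).

Definition fg_of p : freeGroup X := FreeGroup (@wmul_reduced X p [::] isT).

Definition fg_gen (x : X) : freeGroup X := fg_of [:: (x, true)].

Lemma fg_of_nil : fg_of [::] = 1.
Proof. exact/val_inj. Qed.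

Lemma fg_of_cat p q : fg_of (p ++ q) = fg_of p * fg_of q.
Proof.
apply/val_inj; rewrite /= -wmulA ?(word_reduced (fg_of q)) //.
by rewrite /wmul foldr_cat.
Qed.

Lemma fg_of_word u : fg_of (word u) = u.
Proof. by apply/val_inj/wmulw1/word_reduced. Qed.

Lemma fg_of_winv p : fg_of (winv p) = (fg_of p)^-1.
Proof.
apply: (mulIg (fg_of p)); rewrite mulVg -fg_of_cat; apply/val_inj => /=.
elim: p => //= l p IH; rewrite /winv /= rev_cons cat_rcons /wmul foldr_cat /=.
rewrite -{2}[l]linvK pushK; last exact: wmul_reduced.
by rewrite -foldr_cat.
Qed.

Lemma fg_of1 (l : letter X) :
  fg_of [:: l] = if l.2 then fg_gen l.1 else (fg_gen l.1)^-1.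
Proof. by case: l => x []; rewrite // /fg_gen -fg_of_winv. Qed.

Section Lift.
Variables (G : groupType) (g : X -> G).

Definition seq_lift p : G := \prod_(l <- p) (if l.2 then g l.1 else (g l.1)^-1).

Lemma seq_lift_push l p : seq_lift (push l p) = seq_lift (l :: p).
Proof.
case: p => [|m p] //=; case: eqP => // ->.
rewrite /seq_lift !big_cons /=; case: l => x [] /=.
  by rewrite mulVKg.
by rewrite mulKg.
Qed.

(** Free reduction cancels only adjacent inverse factors, so a lift may be computed on any unreduced
    word. This makes [free_liftM] a statement about concatenation. *)
Lemma seq_lift_red p : free_lift g (fg_of p) = seq_lift p.
Proof.
rewrite /free_lift -/(seq_lift _) /=; elim: p => //= l p IH.
by rewrite seq_lift_push {1}/seq_lift big_cons -/(seq_lift _) IH /seq_lift big_cons.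
Qed.

Lemma free_liftM : {morph free_lift g : u v / u * v}.
Proof.
move=> u v; rewrite -{1}[u]fg_of_word -{1}[v]fg_of_word -fg_of_cat seq_lift_red.
by rewrite /seq_lift big_cat.
Qed.

Lemma free_lift1 : free_lift g 1 = 1.
Proof. by rewrite /free_lift big_nil. Qed.

Lemma free_lift_gen x : free_lift g (fg_gen x) = g x.
Proof. by rewrite seq_lift_red /seq_lift big_seq1. Qed.
End Lift.

Section Morph.
Variables (G G' : groupType) (f : G -> G').
Hypothesis fM : {morph f : x y / x * y}.

Lemma morph1g : f 1 = 1.
Proof. by apply: (mulIg (f 1)); rewrite -fM !mul1g. Qed.

Lemma morphVg x : f x^-1 = (f x)^-1.
Proof. by apply: (mulIg (f x)); rewrite -fM !mulVg morph1g. Qed.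

Lemma morph_free_lift (g : X -> G) u : f (free_lift g u) = free_lift (f \o g) u.
Proof.
rewrite /free_lift (big_morph f fM morph1g); apply: eq_bigr => l _.
by case: l.2; rewrite //= morphVg.
Qed.
End Morph.

Lemma free_lift_id u : free_lift fg_gen u = u.
Proof.
rewrite -[in RHS](fg_of_word u) -{1}[u]fg_of_word seq_lift_red.
elim: (word u) => [|l p IH]; first by rewrite /seq_lift big_nil; apply/val_inj.
by rewrite -cat1s fg_of_cat -IH fg_of1 /seq_lift big_cons.
Qed.

Lemma eq_free_lift (G : groupType) (g h : X -> G) u :
  g =1 h -> free_lift g u = free_lift h u.
Proof. by move=> E; apply: eq_bigr => l _; rewrite E. Qed.

End FreeGroups.

(** Subgroups are [Prop]-valued; a classical boolean version lets [has], [find] and finite sets be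
    used with cosets and reachability. *)
Definition decide (P : Prop) : bool := if excluded_middle_informative P then true else false.

Lemma decideP (P : Prop) : reflect P (decide P).
Proof. by rewrite /decide; case: excluded_middle_informative => h; constructor. Qed.

(** * Right cosets of a subgroup *)

Section Cosets.
Variables (G : groupType) (K : G -> Prop).
Hypothesis Ksub : is_subgroup K.
Implicit Types g h k : G.

Definition coseq g h := decide (K (g * h^-1)).

Lemma coseq_refl g : coseq g g.
Proof. by apply/decideP; rewrite mulgV; case: Ksub. Qed.

Lemma coseq_sym g h : coseq g h -> coseq h g.
Proof.
case: Ksub => _ _ KV /decideP/KV; rewrite invgM invgK => ?; exact/decideP.
Qed.

Lemma coseq_trans g h k : coseq g h -> coseq h k -> coseq g k.
Proof.
case: Ksub => _ KM _ /decideP gh /decideP hk; apply/decideP.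
by have := KM _ _ gh hk; rewrite mulgA mulgVK.
Qed.

Lemma coseqM g h k : coseq g h -> coseq (g * k) (h * k).
Proof. by move=> /decideP gh; apply/decideP; rewrite invgM mulgA mulgK. Qed.

Lemma coseq1 g : coseq g 1 <-> K g.
Proof. by split=> [/decideP|?]; [|apply/decideP]; rewrite invg1 mulg1. Qed.

Lemma coseqMr g h k : coseq (g * k) (h * k) -> coseq g h.
Proof. by move=> /(coseqM k^-1); rewrite !mulgK. Qed.
End Cosets.

(** * Invariance of the rank, by abelianization *)

Section RankUniqueness.
Local Open Scope ring_scope.

Section ExponentSum.
Variable n : nat.

(** The abelianization map, with rational coefficients so that matrix rank is available. *)
Definition expsum (p : seq (letter 'I_n)) : 'rV[rat]_n :=
  \sum_(l <- p) (if l.2 then delta_mx 0 l.1 else - delta_mx 0 l.1).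

Lemma expsum_push l p : expsum (push l p) = expsum (l :: p).
Proof.
case: p => [|m p] //=; case: eqP => // ->.
by rewrite /expsum !big_cons; case: l => x [] /=; rewrite addrA ?subrr ?addNr add0r.
Qed.

Lemma expsumM (u v : freeGroup 'I_n) : expsum (u * v)%g = expsum u + expsum v.
Proof.
rewrite /=; elim: (word u) => [|l p IH] /=; first by rewrite {2}/expsum big_nil add0r.
by rewrite expsum_push {1}/expsum big_cons -/(expsum _) IH addrA {3}/expsum big_cons.
Qed.

Lemma expsum1 : expsum (1%g : freeGroup 'I_n) = 0.
Proof. by rewrite /expsum big_nil. Qed.

Lemma expsumV (u : freeGroup 'I_n) : expsum (u^-1)%g = - expsum u.
Proof. by apply: (addIr (expsum u)); rewrite -expsumM mulVg expsum1 addNr. Qed.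
End ExponentSum.

Lemma expsum_free_lift m n (h : 'I_m -> freeGroup 'I_n) u :
  expsum (free_lift h u) = expsum u *m \matrix_j expsum (h j).
Proof.
rewrite /free_lift (big_morph (fun u : freeGroup 'I_n => expsum u) (@expsumM n) (@expsum1 n)).
rewrite [X in _ = X *m _]/expsum mulmx_suml; apply: eq_bigr => l _.
by case: l.2; rewrite ?expsumV ?mulNmx -rowE rowK.
Qed.

(** Write each basis in terms of the other. Substituting one set of words into the other gives back
    the generators, so on exponent sums the n by n identity factors as [N *m M] through dimension m,
    which forces n <= m. *)
Lemma basis_leq (G : groupType) (H : G -> Prop) n m (g : 'I_n -> G) (h : 'I_m -> G) :
  is_basis g H -> is_basis h H -> (n <= m)%N.
Proof.
move=> [gI gH] [hI hH].
have /fin_all_exists[u uP] (j : 'I_m) : exists u, h j = free_lift g u.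
  by apply/gH/hH; exists (fg_gen j); rewrite free_lift_gen.
have /fin_all_exists[w wP] (i : 'I_n) : exists w, g i = free_lift h w.
  by apply/hH/gH; exists (fg_gen i); rewrite free_lift_gen.
pose M := \matrix_j expsum (u j); pose N := \matrix_i expsum (w i).
have NM1 : N *m M = 1%:M.
  apply/row_matrixP => i; rewrite row_mul rowK -expsum_free_lift.
  suff -> : free_lift u (w i) = fg_gen i.
    by rewrite row1 /expsum big_seq1.
  apply: gI; rewrite free_lift_gen wP (morph_free_lift (@free_liftM _ _ g)).
  by apply: eq_free_lift => j /=.
by rewrite -(@mxrank1 rat n) -NM1 (leq_trans (mxrankM_maxr _ _)) ?rank_leq_row.
Qed.

Lemma has_rank_uniq (G : groupType) (H : G -> Prop) n m :
  has_rank H n -> has_rank H m -> n = m.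
Proof.
move=> [g gB] [h hB]; apply/eqP.
by rewrite eqn_leq (basis_leq gB hB) (basis_leq hB gB).
Qed.

End RankUniqueness.

(** * Languages of folded graphs are free *)

Section Walks.
Variables (X : choiceType) (A : lgraph X).
Implicit Types (d : letter (edge A)) (p q : seq (letter (edge A))).
Implicit Types (u v : vertex A).

(* A letter over [edge A] is an edge with a direction of traversal. *)
Definition dsrc d := if d.2 then src d.1 else tgt d.1.
Definition dtgt d := if d.2 then tgt d.1 else src d.1.
Definition dlab d : letter X := (lab d.1, d.2).

Fixpoint walk u p v : bool :=
  if p is d :: p' then (dsrc d == u) && walk (dtgt d) p' v else u == v.

(** Walks may backtrack, so closure under products and inverses is concatenation and reversal of
    walks; for folded graphs [lang_word] recovers a walk that reads the reduced word itself. *)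
Definition lang (g : freeGroup X) : Prop :=
  exists2 p, walk (base A) p (base A) & g = fg_of (map dlab p).

Definition connected : Prop := forall v, exists p, walk (base A) p v.

Lemma dsrc_linv d : dsrc (linv d) = dtgt d.
Proof. by case: d => e []. Qed.

Lemma dtgt_linv d : dtgt (linv d) = dsrc d.
Proof. by case: d => e []. Qed.

Lemma dlab_linv d : dlab (linv d) = linv (dlab d).
Proof. by []. Qed.

Lemma walk_cat u p v q w : walk u p v -> walk v q w -> walk u (p ++ q) w.
Proof. by elim: p u => [|d p IH] u /= => [/eqP->|/andP[-> /IH]]. Qed.

Lemma walk_winv u p v : walk u p v -> walk v (winv p) u.
Proof.
elim: p u => [|d p IH] u /=; first by rewrite eq_sym.
move=> /andP[/eqP<- /IH wp]; rewrite /winv /= rev_cons -cats1.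
by apply: walk_cat wp _; rewrite /= dsrc_linv dtgt_linv !eqxx.
Qed.

Lemma walk_push d p v : walk (dtgt d) p v -> walk (dsrc d) (push d p) v.
Proof.
case: p => [|d' p] /=; first by rewrite eqxx.
by case: (eqVneq d' (linv d)) => [->|_] /=; rewrite ?dtgt_linv ?eqxx //= => /andP[].
Qed.

Lemma walk_red u p v : walk u p v -> walk u (fg_of p) v.
Proof.
rewrite /=; elim: p u => //= d p IH u /andP[/eqP<- /IH].
exact: walk_push.
Qed.

Lemma map_winv p : map dlab (winv p) = winv (map dlab p).
Proof. by rewrite /winv map_rev -!map_comp. Qed.

Lemma dlab_morph p : free_lift (fun e => fg_gen (lab e)) (fg_of p) = fg_of (map dlab p).
Proof.
rewrite seq_lift_red; elim: p => [|d p IH]; first by rewrite /seq_lift big_nil; apply/val_inj.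
by rewrite /= -[in RHS]cat1s fg_of_cat -IH fg_of1 /seq_lift big_cons.
Qed.

Lemma lang_subgroup : is_subgroup lang.
Proof.
split; first by exists [::] => //=; apply/val_inj.
- move=> x y [p pP ->] [q qP ->]; exists (p ++ q); first exact: walk_cat pP qP.
  by rewrite map_cat fg_of_cat.
- move=> x [p pP ->]; exists (winv p); first exact: walk_winv.
  by rewrite map_winv fg_of_winv.
Qed.

(* [t] assigns to each vertex a right coset of [H], and edges are
   compatible with right multiplication by their labels. *)
Definition potential (H : freeGroup X -> Prop) (t : vertex A -> freeGroup X) : Prop :=
  forall e, H (t (src e) * fg_gen (lab e) * (t (tgt e))^-1).

Lemma potential_walk H t u p v : is_subgroup H -> potential H t ->
  walk u p v -> H (t u * fg_of (map dlab p) * (t v)^-1).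
Proof.
move=> [H1 HM HV] tP; elim: p u => [|d p IH] u /=.
  by move=> /eqP->; rewrite fg_of_nil mulg1 mulgV.
move=> /andP[/eqP<- /IH Hp].
rewrite -cat1s fg_of_cat fg_of1 /=.
have Hd : H (t (dsrc d) * (if d.2 then fg_gen (lab d.1) else (fg_gen (lab d.1))^-1)
    * (t (dtgt d))^-1).
  rewrite /dsrc /dtgt; case: d.2; first exact: tP.
  by have := HV _ (tP d.1); rewrite !invgM invgK mulgA.
by have := HM _ _ Hd Hp; rewrite !mulgA mulgVK.
Qed.

(** Along a closed walk the potential telescopes, so the label lies in H after conjugation by an
    element of H. Conversely, the language is a subgroup containing the generators. *)
Lemma lang_potential H t S : is_subgroup H -> generates S H -> potential H t ->
  H (t (base A)) -> (forall s, s \in S -> lang s) -> forall g, lang g <-> H g.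
Proof.
move=> HH SH tP tb SL g; split=> [[p pP ->]|/SH]; last by apply=> //; exact: lang_subgroup.
have [H1 HM HV] := HH.
have := HM _ _ (HM _ _ (HV _ tb) (potential_walk HH tP pP)) tb.
by rewrite !mulgA mulVg mul1g mulgVK.
Qed.

Hypothesis Afold : folded A.

(** Folded graphs are deterministic automata over signed letters. *)
Lemma folded_dart d d' : dsrc d = dsrc d' -> dlab d = dlab d' -> d = d'.
Proof.
case: d d' => e b [e' b'] /= ss [ll bb]; rewrite -{}bb in ss *.
have [->//|/eqP ne] := eqVneq e e'; case: (Afold (e1 := e) (e2 := e')).
by split=> //; case: b ss; [left|right].
Qed.

(** By determinism, two consecutive labels cancel only if the walk backtracks there, so reducing the
    walk and reducing its label agree. *)
Lemma map_red u p v : walk u p v -> map dlab (fg_of p) = word (fg_of (map dlab p)).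
Proof.
rewrite /=; elim: p u => //= d p IH u /andP[_ wp]; rewrite -(IH _ wp).
have := walk_red wp; rewrite /=; case: (wmul p [::]) => //= d' q /andP[/eqP sd' _].
case: (eqVneq d' (linv d)) => [->|ne]; first by rewrite dlab_linv eqxx.
rewrite /= ifN //; apply: contra_neq ne => ld'.
by apply: folded_dart; rewrite ?dsrc_linv.
Qed.

Lemma lang_word g : lang g -> exists2 p, walk (base A) p (base A) & map dlab p = word g.
Proof.
move=> [p pP ->]; exists (word (fg_of p)); first exact: walk_red.
exact: map_red pP.
Qed.

Lemma walk_uniq u p v q w :
  walk u p v -> walk u q w -> map dlab p = map dlab q -> p = q.
Proof.
elim: p q u => [|d p IH] [|d' q] u //= /andP[/eqP <- wp] /andP[/eqP sd wq] [ll bb pq].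
have dd : d = d' by apply: folded_dart; rewrite // /dlab ll bb.
by rewrite dd in wp *; rewrite (IH _ _ wp wq).
Qed.
End Walks.

(** * Spanning trees by shortest walks *)

Section SpanningTree.
Variables (X : choiceType) (A : lgraph X).

(** [dep] is the distance from [r] along edges in [P], and [par v] is the last step of a shortest
    walk to [v]. The predicate [P] allows an edge to be forbidden, as [incident_choice] requires. *)
Lemma spanning_tree (P : pred (edge A)) (r : vertex A) :
  (forall v, exists2 p, walk r p v & all (fun d => P d.1) p) ->
  exists (par : {v | v != r} -> letter (edge A)) (dep : vertex A -> nat),
  [/\ forall v, dtgt (par v) = val v, forall v, P (par v).1 &
      forall v, dep (dsrc (par v)) < dep (val v)].
Proof.
move=> reach.
pose Q v n := [exists p : n.-tuple (letter (edge A)), walk r p v && all (fun d => P d.1) p].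
have Qex v : exists n, Q v n.
  have [p wp Pp] := reach v; exists (size p); apply/existsP.
  by exists (in_tuple p); rewrite wp.
pose dep v := ex_minn (Qex v).
suff /fin_all_exists[par parP] (v : {v | v != r}) : exists d,
    [/\ dtgt d = val v, P d.1 & dep (dsrc d) < dep (val v)].
  by exists par, dep; split=> v; case: (parP v).
case: v => v /= vr; rewrite {2}/dep; case: ex_minnP => n /existsP[p /andP[wp Pp]] _.
have last_step d q u : walk u (rcons q d) v -> dtgt d = v /\ walk u q (dsrc d).
  elim: q u => [|d' q IH] u /=; first by move=> /andP[/eqP-> /eqP].
  by move=> /andP[-> /IH].
case: (lastP (tval p)) (size_tuple p) wp Pp => [|q d] /=.
  by rewrite eq_sym (negbTE vr).
rewrite size_rcons all_rcons => <- /last_step[td wq] /andP[Pd Pq].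
exists d; split=> //; rewrite ltnS /dep; case: ex_minnP => m _; apply.
by apply/existsP; exists (in_tuple q); rewrite wq.
Qed.

(** If two vertices shared a tree edge in opposite directions, each would be strictly less deep than
    the other; in the same direction they are the same end of it. *)
Lemma tree_edge_inj r (par : {v | v != r} -> letter (edge A)) dep :
  (forall v, dtgt (par v) = val v) -> (forall v, dep (dsrc (par v)) < dep (val v)) ->
  injective (fun v => (par v).1).
Proof.
move=> parP depP v w; have := depP v; have := depP w; rewrite -!parP => dw dv e.
apply/val_inj; rewrite -!parP; move: e dw dv.
rewrite /dtgt /dsrc; case: (par v) (par w) => [e []] [e' []] /= -> //; lia.
Qed.
End SpanningTree.

Section LangRank.
Variables (X : choiceType) (A : lgraph X).
Hypotheses (Afold : folded A) (Aconn : connected A).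

(** The edges outside a spanning tree index a basis: each gives the loop that reaches it and returns
    along the tree. Freeness comes from collapsing the tree, a left inverse, together with
    injectivity of labels on reduced loops. *)
Lemma lang_rank : #|vertex A| <= #|edge A|.+1 /\
  has_rank (lang A) (#|edge A|.+1 - #|vertex A|).
Proof.
have [v|par [dep [parP _ depP]]] := @spanning_tree X A predT (base A).
  by have [p] := Aconn v; exists p; rewrite ?all_predT.
pose T := [set (par v).1 | v : {v | v != base A}].
have cardT : #|T|.+1 = #|vertex A|.
  rewrite card_imset; last exact: tree_edge_inj parP depP.
  by rewrite card_sig -(cardC (pred1 (base A))) card1.
have cardTC : #|T| + #|~: T| = #|edge A| by rewrite cardsC.
split; first by lia.
rewrite (_ : _ - _ = #|~: T|); last by lia.
(* [tau v] is the tree path from the base to [v], as an element of the free group on edges. The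
   recursion runs on fuel, and any fuel above [dep v] gives the same value. *)
pose tau_rec := fix tau n v : freeGroup (edge A) := if n is n'.+1 then
  if insub v is Some w then tau n' (dsrc (par w)) * fg_of [:: par w] else 1 else 1.
pose tau v := tau_rec (dep v).+1 v.
have tau_stable n m v : dep v < n -> dep v < m -> tau_rec n v = tau_rec m v.
  elim: n m v => [|n IH] [|m] v //= vn vm; case: insubP => // w _ wv.
  by rewrite (IH m) //; have := depP w; rewrite wv; lia.
have tauE w : tau (val w) = tau (dsrc (par w)) * fg_of [:: par w].
  rewrite {1}/tau /= valK; congr (_ * _); apply: tau_stable => //.
have tau_base : tau (base A) = 1 by rewrite /tau /= insubF ?eqxx.
have tau_ind (Q : vertex A -> freeGroup (edge A) -> Prop) : Q (base A) 1 ->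
    (forall w, Q (dsrc (par w)) (tau (dsrc (par w))) -> Q (val w) (tau (val w))) ->
    forall v, Q v (tau v).
  move=> Q1 QS v; have [n] := ubnP (dep v); elim: n v => // n IH v vn.
  have [vb|vb] := eqVneq v (base A); first by rewrite vb tau_base.
  have := QS (Sub v vb); rewrite SubK; apply; apply: IH.
  by have := depP (Sub v vb); rewrite SubK; lia.
(* [kap e] is the loop through [e] along the tree; [c] collapses the tree, hence
   maps the loops [kap e], e not in [T], to free generators. *)
pose kap e := tau (src e) * fg_gen e * (tau (tgt e))^-1.
have kapT e : e \in T -> kap e = 1.
  case/imsetP=> w _ ->; rewrite /kap; have := tauE w; rewrite -parP.
  rewrite /dsrc /dtgt fg_of1; case: (par w) => f [] /= ->; first by rewrite mulgV.
  by rewrite mulgVK mulgV.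
pose c e : freeGroup 'I_#|~: T| :=
  if [pick i | enum_val i == e] is Some i then fg_gen i else 1.
have cT e : e \in T -> c e = 1.
  rewrite /c; case: pickP => // i /eqP<-.
  by have := enum_valP i; rewrite inE => /negbTE->.
have cN i : c (enum_val i) = fg_gen i.
  rewrite /c; case: pickP => [j /eqP/enum_val_inj->//|/(_ i)].
  by rewrite eqxx.
have c_tau v : free_lift c (tau v) = 1.
  elim/tau_ind: {v}(tau v) => [|w IH]; first exact: free_lift1.
  have pT : (par w).1 \in T by apply/imsetP; exists w.
  rewrite tauE free_liftM IH seq_lift_red /seq_lift big_seq1 cT //.
  by case: (par w).2; rewrite ?mulg1 // invg1 mulg1.
pose k (i : 'I_#|~: T|) := kap (enum_val i).
have ck i : free_lift c (k i) = fg_gen i.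
  rewrite /k /kap !free_liftM (morphVg (@free_liftM _ _ c)) !c_tau free_lift_gen.
  by rewrite cN mul1g invg1 mulg1.
have ckK : cancel (free_lift k) (free_lift c).
  move=> y; rewrite (morph_free_lift (@free_liftM _ _ c)) -[RHS]free_lift_id.
  exact: eq_free_lift.
have kc e : kap e = free_lift k (c e).
  rewrite /c; case: pickP => [i /eqP<-|eN]; first by rewrite free_lift_gen.
  rewrite free_lift1 kapT //; apply/negPn/negP => eT.
  have eTC : e \in ~: T by rewrite inE.
  by have := eN (enum_rank_in eTC e); rewrite enum_rankK_in ?eqxx.
pose lam := free_lift (fun e : edge A => fg_gen (lab e)).
pose loops (z : freeGroup (edge A)) := walk (base A) z (base A).
(* Reading labels is injective on reduced closed walks, because the graph is folded. *)
have lam_inj y z : loops y -> loops z -> lam y = lam z -> y = z.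
  move=> ly lz; rewrite /lam -[y]fg_of_word -[z]fg_of_word !dlab_morph.
  rewrite !fg_of_word => /(congr1 (@word _)).
  rewrite -(map_red Afold ly) -(map_red Afold lz) !fg_of_word.
  by move=> /(walk_uniq Afold ly lz) yz; apply/val_inj.
have walk_tau v : walk (base A) (tau v) v.
  elim/tau_ind: {v}(tau v) => [|w IH] //=.
  rewrite tauE -[tau _]fg_of_word -fg_of_cat; apply: walk_red.
  by apply: walk_cat IH _; rewrite /= eqxx parP /=.
have loops_kap e : loops (kap e).
  rewrite /loops /kap -[tau (src e)]fg_of_word -[tau (tgt e)]fg_of_word.
  rewrite -fg_of_winv -!fg_of_cat; apply: walk_red.
  apply: walk_cat (walk_winv (walk_tau _)).
  by apply: walk_cat (walk_tau _) _; rewrite /= /dsrc /dtgt /= !eqxx.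
have loops_k y : loops (free_lift k y).
  rewrite /free_lift; apply: (big_ind loops) => [|x z|[i []] _ /=].
  - exact: eqxx.
  - rewrite /loops -{2}[x]fg_of_word -{2}[z]fg_of_word -fg_of_cat => lx lz.
    by apply: walk_red; apply: walk_cat lx lz.
  - exact: loops_kap.
  rewrite /loops -[k i]fg_of_word -fg_of_winv.
  by apply: walk_red; apply: walk_winv; exact: loops_kap.
have lamk y : free_lift (fun i => lam (k i)) y = lam (free_lift k y).
  by rewrite /lam (morph_free_lift (@free_liftM _ _ _)).
exists (fun i => lam (k i)); split=> [y z|x].
  rewrite !lamk => /lam_inj yz; apply: (can_inj ckK); exact: yz.
split=> [[p wp ->]|[y ->]]; last first.
  rewrite lamk; exists (free_lift k y); first exact: loops_k.
  by rewrite -dlab_morph fg_of_word.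
exists (seq_lift c p); rewrite lamk -dlab_morph; congr lam.
(* Inserting tree paths to and from the base at every vertex of a walk writes it as a product of the
   loops [kap e]. *)
suff tele u v q : walk u q v -> tau u * fg_of q * (tau v)^-1 = free_lift k (seq_lift c q).
  by rewrite -(tele _ _ _ wp) tau_base mul1g invg1 mulg1.
elim: q u => [|d q IH] u /=.
  by move=> /eqP->; rewrite /seq_lift big_nil free_lift1 fg_of_nil mulg1 mulgV.
move=> /andP[/eqP<- /IH E]; rewrite /seq_lift big_cons free_liftM -/(seq_lift _ _) -{}E.
rewrite -cat1s fg_of_cat fg_of1 !mulgA; congr (_ * _ * _).
rewrite /dsrc /dtgt; case: d => e [] /=; first by rewrite -kc /kap mulgVK.
rewrite (morphVg (@free_liftM _ _ k)) -kc /kap !invgM invgK !mulgA mulgVK //.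
Qed.
End LangRank.

(** * The pullback inequality *)

Section Orientation.
Variables (X : choiceType) (B : lgraph X).
Hypotheses (Bconn : connected B) (BVE : #|vertex B| <= #|edge B|).

(* A spanning tree together with one further edge, rooted at an end of that
   edge, lets every vertex choose an incident edge. *)
Lemma incident_choice : exists eta : {ffun vertex B -> letter (edge B)},
  (forall v, dsrc (eta v) = v) /\ injective (fun v => (eta v).1).
Proof.
have [v|par [dep [parP _ depP]]] := @spanning_tree X B predT (base B).
  by have [p] := Bconn v; exists p; rewrite ?all_predT.
pose T := [set (par v).1 | v : {v | v != base B}].
have cardT : #|T|.+1 = #|vertex B|.
  rewrite card_imset; last exact: tree_edge_inj parP depP.
  by rewrite card_sig -(cardC (pred1 (base B))) card1.
(* The tree has one edge fewer than there are vertices, hence misses some edge [e0]; without [e0]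
   the graph is still connected. *)
have [e0 e0T|T0] := pickP [predC T]; last first.
  have := cardC T; rewrite (eq_card0 (A := [predC T])) //.
  by move: cardT BVE; lia.
pose P := [pred e | e != e0].
have reach v : exists2 p, walk (base B) p v & all (fun d => P d.1) p.
  have [n] := ubnP (dep v); elim: n v => // n IH v vn.
  have [->|vb] := eqVneq v (base B); first by exists [::] => //=.
  pose w : {v | v != base B} := Sub v vb.
  have wv : val w = v by rewrite SubK.
  have [|p wp Pp] := IH (dsrc (par w)).
    by have := depP w; rewrite wv; lia.
  exists (rcons p (par w)).
    by rewrite -cats1; apply: walk_cat wp _; rewrite /= eqxx parP wv /=.
  rewrite all_rcons Pp andbT /=; apply: contraNneq e0T => <-.
  by apply/imsetP; exists w.
have [v|par' [dep' [parP' parN depP']]] := @spanning_tree X B P (src e0).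
  have [p wp Pp] := reach (src e0); have [q wq Pq] := reach v.
  exists (winv p ++ q); first exact: walk_cat (walk_winv wp) wq.
  rewrite all_cat Pq andbT /winv all_rev all_map.
  by apply: sub_all Pp => d.
(* The root [src e0] chooses [e0], and every other vertex its edge towards the parent. The second
   tree avoids [e0], so there is no clash. *)
exists [ffun v => if insub v is Some w then linv (par' w) else (e0, true)].
split=> [v|v v'].
  rewrite ffunE; case: insubP => [w _ <-|]; first by rewrite dsrc_linv parP'.
  by rewrite negbK => /eqP->.
rewrite !ffunE; case: insubP => [w _ <-|]; case: insubP => [w' _ <-|] /=.
- by move=> ww; congr val; apply: (tree_edge_inj parP' depP').
- by move=> _ e; have := parN w; rewrite /= e eqxx.
- by move=> _ e; have := parN w'; rewrite /= -e eqxx.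
by rewrite !negbK => /eqP-> /eqP->.
Qed.

Lemma orientation : exists eta : vertex B -> letter (edge B),
  [/\ forall v, dsrc (eta v) = v, injective (fun v => (eta v).1) &
      forall e, (forall v, (eta v).1 != e) -> (eta (src e)).2].
Proof.
have [f0 [f0P f0I]] := incident_choice.
pose valid (f : {ffun vertex B -> letter (edge B)}) :=
  [forall v, dsrc (f v) == v] && injectiveb (fun v => (f v).1).
have f0V : valid f0.
  by apply/andP; split; [apply/forallP=> v; rewrite f0P | apply/injectiveP].
case: (arg_maxnP (fun f : {ffun vertex B -> letter (edge B)} => #|[set v | (f v).2]|) f0V).
move=> f /andP[/forallP fP /injectiveP fI] fmax; exists f; split=> // [v|e eN].
  exact/eqP.
apply/negPn/negP => nout.
(* Switching [src e] to [e] keeps the choice injective, as [e] was not chosen, and adds one outgoing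
   choice, against maximality. *)
pose f' := [ffun v => if v == src e then (e, true) else f v].
have f'V : valid f'.
  apply/andP; split; first by apply/forallP=> v; rewrite ffunE; case: (eqVneq v (src e)) => [->|_].
  apply/injectiveP => v w; rewrite !ffunE.
  case: eqP => [->|_]; case: eqP => [->|_] //= E.
  - by have := eN w; rewrite E eqxx.
  - by have := eN v; rewrite E eqxx.
  - exact: fI.
have := fmax _ f'V; rewrite /= leqNgt => /negP[]; apply: proper_card.
apply/properP; split.
  by apply/subsetP => v; rewrite !inE ffunE; case: eqP.
by exists (src e); rewrite !inE ?ffunE ?eqxx.
Qed.
End Orientation.

Section Pullback.
Variable X : choiceType.
Implicit Types A B : lgraph X.

Definition pullback A B : lgraph X :=
  @LGraph X (vertex A * vertex B)%type {ee : edge A * edge B | lab ee.1 == lab ee.2}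
    (fun e => (src (val e).1, src (val e).2)) (fun e => (tgt (val e).1, tgt (val e).2))
    (fun e => lab (val e).1) (base A, base B).

Definition reversal A : lgraph X := LGraph (@tgt X A) (@src X A) (@lab X A) (base A).

Lemma folded_src A : folded A -> forall e e' : edge A,
  src e = src e' -> lab e = lab e' -> e = e'.
Proof.
move=> Af e e' s l; suff [] : (e, true) = (e', true) by [].
by apply: (folded_dart Af); rewrite // /dlab l.
Qed.

Lemma folded_tgt A : folded A -> forall e e' : edge A,
  tgt e = tgt e' -> lab e = lab e' -> e = e'.
Proof.
move=> Af e e' s l; suff [] : (e, false) = (e', false) by [].
by apply: (folded_dart Af); rewrite // /dlab l.
Qed.

(* Let every vertex of [B] choose an incident edge as in [orientation]. An edge
   (e, e') of the pullback is sent to its end lying over the vertex that chose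
   e', or to its source if e' is not chosen; this is injective away from the
   edges with e' not chosen and [src e] of out-degree at least 2. *)
Lemma pullback_bound A B (D : {set vertex (pullback A B)}) :
  folded A -> folded B -> connected B -> #|vertex B| <= #|edge B| ->
  (forall e : edge (pullback A B), (src e \in D) = (tgt e \in D)) ->
  #|[set e : edge (pullback A B) | src e \in D]| <=
    #|D| + #|[set u : vertex A | 1 < outdeg u]| * (#|edge B| - #|vertex B|).
Proof.
move=> Af Bf Bc BVE Dcl; have [eta [etaP etaI etaO]] := orientation Bc BVE.
pose N := ~: [set (eta v).1 | v : vertex B].
have cardN : #|N| = #|edge B| - #|vertex B|.
  by rewrite -(card_imset _ etaI) -[#|edge B|](cardsC [set (eta v).1 | v : vertex B]) addKn.
have chosen e : e \notin N -> exists v, (eta v).1 = e.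
  by rewrite inE negbK => /imsetP[v _ ->]; exists v.
have unchosen e : e \in N -> forall v, (eta v).1 != e.
  by move=> + v; rewrite inE; apply: contraNneq => <-; apply/imsetP; exists v.
pose ED := [set e : edge (pullback A B) | src e \in D].
pose bad := [set e : edge (pullback A B) |
  ((val e).2 \in N) && (1 < outdeg (src (val e).1))].
rewrite -/ED -(cardsID bad ED) addnC leq_add //; last first.
  (* A bad edge is determined by the source of its first component and by its second component: the
     latter fixes the label, and [A] is folded. *)
  rewrite -cardN -cardsX.
  rewrite -(card_in_imset (f := fun e : edge (pullback A B) => (src (val e).1, (val e).2))).
    apply/subset_leq_card/subsetP => _ /imsetP[e + ->].
    by rewrite !inE => /andP[_ /andP[-> ->]].
  move=> [[e1 e2] /= le] [[f1 f2] /= lf] _ _ /= [s12 E2]; apply/val_inj => /=.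
  congr (_, _) => //; apply: (folded_src Af) => //.
  by rewrite (eqP le) (eqP lf) E2.
pose cin (e : edge (pullback A B)) := eta (tgt (val e).2) == ((val e).2, false).
pose Phi e := if cin e then tgt e else src e.
rewrite -(card_in_imset (f := Phi)); last first.
  have cout (e : edge (pullback A B)) : ~~ cin e -> (val e).2 \notin N ->
      eta (src (val e).2) = ((val e).2, true).
    move=> cN /chosen[v ev]; have := etaP v; rewrite /dsrc; move: cN ev; rewrite /cin.
    case E : (eta v) => [f []] /= + fe; rewrite fe => cN sv; first by rewrite sv E fe.
    by move: cN; rewrite sv E fe eqxx.
  (* A common image would lie over a vertex of [B] that chooses an incoming edge because of [e], but
     an outgoing one because of [e'], whether or not the second component of [e'] is chosen. *)
  have mixed e e' : cin e -> ~~ cin e' -> tgt e = src e' -> False.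
    move=> /eqP ce ce' [_ ts].
    have [eN|eN] := boolP ((val e').2 \in N).
      by have := etaO _ (unchosen _ eN); rewrite -ts ce.
    by have := cout _ ce' eN; rewrite -ts ce.
  (* Outside [bad], the source in [A] has at most one outgoing edge. So the first components agree,
     hence the labels, hence the second components since [B] is folded. *)
  have uncho (e e' : edge (pullback A B)) : (val e).2 \in N -> e \notin bad ->
      src e = src e' -> e = e'.
    move=> eN; rewrite inE eN /= -leqNgt => od [s1 s2]; apply/val_inj.
    have E1 : (val e).1 = (val e').1.
      apply/eqP/negPn/negP => ne; move: od; rewrite leqNgt => /negP[].
      rewrite /outdeg (cardsD1 (val e).1) (cardsD1 (val e').1) !inE eqxx.
      by rewrite -s1 eqxx eq_sym ne.
    apply/eqP; rewrite -pair_eqE /pair_eq E1 eqxx /=; apply/eqP.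
    by apply: (folded_src Bf) => //; rewrite -(eqP (valP e)) -(eqP (valP e')) E1.
  move=> e e' /setDP[_ eb] /setDP[_ eb']; rewrite /Phi.
  case: ifP => [ce|/negbT ce]; case: ifP => [ce'|/negbT ce'] E.
  - move: ce ce'; rewrite /cin; case: E => t1 <- /eqP-> /eqP[E2].
    apply/val_inj/eqP; rewrite -pair_eqE /pair_eq E2 eqxx andbT; apply/eqP.
    by apply: (folded_tgt Af) => //; rewrite (eqP (valP e)) (eqP (valP e')) E2.
  - by case: (mixed _ _ ce ce' E).
  - by case: (mixed _ _ ce' ce (esym E)).
  have [eN|eN] := boolP ((val e).2 \in N); first exact: uncho.
  have [eN'|eN'] := boolP ((val e').2 \in N); first exact/esym/uncho.
  have := cout _ ce eN; case: E => s1 ->; rewrite cout // => -[E2].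
  apply/val_inj/eqP; rewrite -pair_eqE /pair_eq -E2 eqxx andbT; apply/eqP.
  by apply: (folded_src Af) => //; rewrite (eqP (valP e)) (eqP (valP e')) E2.
apply/subset_leq_card/subsetP => _ /imsetP[e + ->]; case/setDP=> + _; rewrite inE => eD.
by rewrite /Phi; case: ifP => _; rewrite -?Dcl.
Qed.

Lemma reversal_folded A : folded A -> folded (reversal A).
Proof.
move=> Af e e' [ne l st]; apply: (Af e e'); split=> //.
by case: st => E; [right | left].
Qed.

Lemma reversal_connected A : connected A -> connected (reversal A).
Proof.
move=> Ac v; have [p wp] := Ac v; exists (map (@linv _) p).
change (base (reversal A)) with (base A); move: (base A) wp.
elim: p => [|[e b] p IH] u //= /andP[su /IH wp].
by case: b su wp; rewrite /dsrc /dtgt /= => ->.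
Qed.

(** Reversing all edges exchanges in-degree and out-degree. Since [D] is closed under adjacency,
    counting its edges by target or by source is the same. *)
Lemma pullback_bound_rev A B (D : {set vertex (pullback A B)}) :
  folded A -> folded B -> connected B -> #|vertex B| <= #|edge B| ->
  (forall e : edge (pullback A B), (src e \in D) = (tgt e \in D)) ->
  #|[set e : edge (pullback A B) | src e \in D]| <=
    #|D| + #|[set u : vertex A | 1 < indeg u]| * (#|edge B| - #|vertex B|).
Proof.
move=> Af Bf Bc BVE Dcl.
have /= := @pullback_bound (reversal A) (reversal B) D (reversal_folded Af)
  (reversal_folded Bf) (reversal_connected Bc) BVE (fun e => esym (Dcl e)).
by congr (_ <= _); apply: eq_card => e; rewrite !inE; exact/esym/Dcl.
Qed.

Lemma edges_outdeg A : (forall v : vertex A, 0 < outdeg v <= 2) ->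
  #|edge A| = #|vertex A| + #|[set u : vertex A | 1 < outdeg u]|.
Proof.
move=> od; have -> : #|edge A| = (\sum_(v : vertex A) outdeg v)%N.
  rewrite -[LHS]sum1_card (partition_big (@src X A) predT) //=.
  by apply: eq_bigr => v _; rewrite sum1dep_card.
rewrite -[#|vertex A|]sum1_card -sum1dep_card [in X in _ + X]big_mkcond -big_split /=.
by apply: eq_bigr => v _; have := od v; case: (outdeg v) => [|[|[|]]].
Qed.

Lemma edges_indeg A : (forall v : vertex A, 0 < indeg v <= 2) ->
  #|edge A| = #|vertex A| + #|[set u : vertex A | 1 < indeg u]|.
Proof. exact: (@edges_outdeg (reversal A)). Qed.

End Pullback.

(** * Connected components and intersections *)

Section Component.
Variables (X : choiceType) (A : lgraph X).

Definition component : {set vertex A} :=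
  [set v | decide (exists p, walk (base A) p v)].

Lemma componentP v : reflect (exists p, walk (base A) p v) (v \in component).
Proof. by rewrite inE; exact: decideP. Qed.

Lemma base_component : base A \in component.
Proof. by apply/componentP; exists [::] => /=. Qed.

Lemma component_edge (e : edge A) : (src e \in component) = (tgt e \in component).
Proof.
apply/componentP/componentP => -[p wp].
  exists (rcons p (e, true)); rewrite -cats1; apply: walk_cat wp _.
  by rewrite /= /dsrc /dtgt !eqxx.
exists (rcons p (e, false)); rewrite -cats1; apply: walk_cat wp _.
by rewrite /= /dsrc /dtgt !eqxx.
Qed.

Lemma component_tgt (e : {e : edge A | src e \in component}) : tgt (val e) \in component.
Proof. by rewrite -component_edge; exact: (valP e). Qed.

Definition component_graph : lgraph X :=
  @LGraph X {v : vertex A | v \in component} {e : edge A | src e \in component}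
    (fun e => Sub (src (val e)) (valP e)) (fun e => Sub (tgt (val e)) (component_tgt e))
    (fun e => lab (val e)) (Sub (base A) base_component).

Lemma component_folded : folded A -> folded component_graph.
Proof.
move=> Af e e' [ne /= l st]; apply: (Af (val e) (val e')); split=> //.
  by move/val_inj.
by case: st => -[E]; [left|right].
Qed.

Definition component_val : vertex component_graph -> vertex A :=
  fun v : {v : vertex A | v \in component} => val v.

Let down (d : letter (edge component_graph)) : letter (edge A) := (val d.1, d.2).

Let val_dsrc (d : letter (edge component_graph)) : component_val (dsrc d) = dsrc (down d).
Proof. by case: d => e []. Qed.

Let val_dtgt (d : letter (edge component_graph)) : component_val (dtgt d) = dtgt (down d).
Proof. by case: d => e []. Qed.

Lemma component_walk u v p : walk (component_val u) p (component_val v) <->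
  exists2 q : seq (letter (edge component_graph)), walk u q v & map down q = p.
Proof.
split=> [|[q + <-]]; last first.
  elim: q u => [|d q IH] u /= => [/eqP->//|/andP[/eqP<- /IH]].
  by rewrite val_dsrc val_dtgt eqxx.
elim: p u => [|[e b] p IH] u /= => [/eqP/val_inj->|]; first by exists [::] => /=.
move=> /andP[/eqP su wp].
have es : src e \in component.
  by have := valP u; rewrite -/(component_val u) -su; case: b {su wp}; rewrite //= component_edge.
pose d : letter (edge component_graph) := (Sub e es, b).
have [|q wq qp] := IH (dtgt d); first by rewrite val_dtgt /down /=.
exists (d :: q); last by rewrite /= qp.
by rewrite /= wq andbT; apply/eqP/val_inj; rewrite -/(component_val _) val_dsrc.
Qed.

Lemma component_connected : connected component_graph.
Proof.
move=> v; have /componentP[p] := valP v.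
by rewrite -[base A]/(component_val (base component_graph)) => /component_walk[q wq _]; exists q.
Qed.

Lemma component_lang g : lang component_graph g <-> lang A g.
Proof.
have lq (q : seq (letter (edge component_graph))) :
    map (@dlab _ _) (map down q) = map (@dlab _ _) q by rewrite -map_comp.
split=> [[q wq ->]|[p wp ->]].
  exists (map down q); last by rewrite lq.
  by rewrite -[base A]/(component_val (base component_graph)); apply/component_walk; exists q.
move: wp; rewrite -[base A]/(component_val (base component_graph)) => /component_walk[q wq <-].
by exists q; rewrite ?lq.
Qed.

Lemma card_component_vertices : #|vertex component_graph| = #|component|.
Proof. by rewrite card_sig; apply: eq_card. Qed.

Lemma card_component_edges :
  #|edge component_graph| = #|[set e : edge A | src e \in component]|.
Proof. by rewrite card_sig; apply: eq_card => e; rewrite inE. Qed.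

End Component.

Section PullbackLang.
Variables (X : choiceType) (A B : lgraph X).

Lemma pullback_folded : folded A -> folded B -> folded (pullback A B).
Proof.
move=> Af Bf e e' [ne /= l st]; apply: ne; apply/val_inj/eqP.
rewrite -pair_eqE; apply/andP; split; apply/eqP; case: st => -[E1 E2].
- exact: (folded_src Af).
- exact: (folded_tgt Af).
- by apply: (folded_src Bf) => //; rewrite -(eqP (valP e)) -(eqP (valP e')).
- by apply: (folded_tgt Bf) => //; rewrite -(eqP (valP e)) -(eqP (valP e')).
Qed.

(** Walks in the pullback project to both factors. Conversely, foldedness lets both graphs read the
    reduced word of [g] itself, and two walks with the same label pair up edge by edge. *)
Lemma pullback_lang : folded A -> folded B ->
  forall g, lang (pullback A B) g <-> lang A g /\ lang B g.
Proof.
move=> Af Bf g; split=> [[p wp ->]|[/(lang_word Af)[p wp pg] /(lang_word Bf)[q wq qg]]].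
  split.
    exists (map (fun d : letter (edge (pullback A B)) => ((val d.1).1, d.2)) p).
      (* Only the start of the walk is generalized for the induction; its end remains the base. *)
      have [u uE] : {u | u = base (pullback A B)} by exists (base (pullback A B)).
      change (base A) with (base (pullback A B)).1; rewrite -{1}uE; rewrite -{1}uE in wp.
      elim: p u {uE} wp => [|[e b] p IH] u /= => [/eqP->//|/andP[/eqP<- /IH]].
      by rewrite /dsrc /dtgt; case: b => /= ->; rewrite eqxx.
    by rewrite -map_comp.
  exists (map (fun d : letter (edge (pullback A B)) => ((val d.1).2, d.2)) p).
    have [u uE] : {u | u = base (pullback A B)} by exists (base (pullback A B)).
    change (base B) with (base (pullback A B)).2; rewrite -{1}uE; rewrite -{1}uE in wp.
    elim: p u {uE} wp => [|[e b] p IH] u /= => [/eqP->//|/andP[/eqP<- /IH]].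
    by rewrite /dsrc /dtgt; case: b => /= ->; rewrite eqxx.
  rewrite -map_comp; congr fg_of; apply: eq_map => d.
  by rewrite /dlab /= (eqP (valP d.1)).
suff [r wr rp] : exists2 r : seq (letter (edge (pullback A B))),
    walk (base (pullback A B)) r (base (pullback A B)) & map (@dlab _ _) r = map (@dlab _ _) p.
  by exists r; rewrite // rp pg fg_of_word.
rewrite -qg in pg; change (base (pullback A B)) with (base A, base B).
move: {1 3}(base A) {1 3}(base B) wp wq {qg} pg.
elim: p q => [|[e b] p IH] [|[f c] q] u v //= => [/eqP-> /eqP->|].
  by exists [::]; rewrite /= ?eqxx.
move=> /andP[/eqP<- wp] /andP[/eqP<- wq] [le bc pq]; rewrite -{}bc in wq *.
have [r wr rp] := IH _ _ _ wp wq pq; move/eqP in le.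
exists ((Sub (e, f) le, b) :: r); last by rewrite /= rp.
by rewrite /= {1}/dsrc; case: b wp wq wr => /= _ _ wr; rewrite eqxx.
Qed.

End PullbackLang.

(** * Induced subgraphs of Schreier graphs *)

Section Schreier.
Variables (X : finType) (K : freeGroup X -> Prop) (S : seq (freeGroup X)).
Hypotheses (Ksub : is_subgroup K) (KS : generates S K).
Implicit Types g h : freeGroup X.

Notation coseq := (coseq K).
Let coseq_refl := coseq_refl Ksub.
Let coseq_sym := coseq_sym Ksub.
Let coseq_trans := coseq_trans Ksub.

(** The cosets met while reading generators from the base; the leading 1 provides the base even when
    [S] is empty. *)
Definition prefixes : seq (freeGroup X) :=
  1 :: [seq fg_of (take k (word s)) | s <- S, k <- iota 0 (size (word s)).+1].

Definition coset_rep g := nth 1 prefixes (find (coseq g) prefixes).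

Definition visited g := has (coseq g) prefixes.

Lemma coseq_rep g : visited g -> coseq g (coset_rep g).
Proof. exact: nth_find. Qed.

Lemma eq_coset_rep g h : coseq g h -> coset_rep g = coset_rep h.
Proof.
move=> gh; congr nth; apply: eq_find => k.
by apply/idP/idP; apply: coseq_trans => //; exact: coseq_sym.
Qed.

Lemma eq_visited g h : coseq g h -> visited g = visited h.
Proof.
move=> gh; apply: eq_has => k.
by apply/idP/idP; apply: coseq_trans => //; exact: coseq_sym.
Qed.

Lemma visited_prefix g : g \in prefixes -> visited g.
Proof. by move=> gP; apply/hasP; exists g; rewrite ?coseq_refl. Qed.

Definition reps := [seq coset_rep g | g <- prefixes].

Lemma rep_mem g : visited g -> coset_rep g \in reps.
Proof.
move=> vg; rewrite (eq_coset_rep (coseq_rep vg)); apply: map_f.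
by apply: mem_nth; rewrite -has_find.
Qed.

Lemma reps_visited g : g \in reps -> visited g.
Proof.
move=> /mapP[h /visited_prefix vh ->].
by rewrite -(eq_visited (coseq_rep vh)).
Qed.

Lemma rep_id g : g \in reps -> coset_rep g = g.
Proof.
move=> /mapP[h /visited_prefix vh ->].
by rewrite -(eq_coset_rep (coseq_rep vh)).
Qed.

Definition sch_vertex : finType := seq_sub reps.

Definition sch_vertex1 : sch_vertex := SeqSub (rep_mem (visited_prefix (mem_head _ _))).

(** For visited [g] the representative lies in [reps], so the default is not reached. *)
Definition coset_vertex g : sch_vertex := insubd sch_vertex1 (coset_rep g).

Lemma coset_vertexP g : visited g -> coseq g (val (coset_vertex g)).
Proof. by move=> vg; rewrite insubdK; [exact: coseq_rep | exact: rep_mem]. Qed.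

Lemma coseq_vertex (v w : sch_vertex) : coseq (val v) (val w) -> v = w.
Proof.
move=> /eq_coset_rep E; apply: val_inj; move: E.
by rewrite !rep_id //; exact: valP.
Qed.

(* The subgraph of the Schreier graph of [K] induced by the cosets of the
   prefixes of the generators. *)
Definition schreier : lgraph X :=
  @LGraph X sch_vertex {ve : sch_vertex * X | visited (val ve.1 * fg_gen ve.2)}
    (fun e => (val e).1) (fun e => coset_vertex (val (val e).1 * fg_gen (val e).2))
    (fun e => (val e).2) (coset_vertex 1).

Lemma schreier_edge (e : edge schreier) :
  coseq (val (src e) * fg_gen (lab e)) (val (tgt e)).
Proof. exact: coset_vertexP (valP e). Qed.

Lemma schreier_potential : potential K (fun v : vertex schreier => val v).
Proof. by move=> e; exact/decideP/schreier_edge. Qed.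

Lemma schreier_folded : folded schreier.
Proof.
move=> e e' [ne l st]; apply: ne.
have ss : src e = src e'.
  case: st => // tt; apply: coseq_vertex.
  have h := coseq_sym (schreier_edge e'); rewrite -tt -l in h.
  exact: coseqMr (coseq_trans (schreier_edge e) h).
apply/val_inj; move: ss l => /=.
by case: (val e) (val e') => [v x] [w y] /= -> ->.
Qed.

Lemma schreier_step g x : visited g -> visited (g * fg_gen x) ->
  exists e : edge schreier, [/\ src e = coset_vertex g,
    tgt e = coset_vertex (g * fg_gen x) & lab e = x].
Proof.
move=> vg vgx; have cg := coseqM (fg_gen x) (coset_vertexP vg).
have vE : visited (val (coset_vertex g) * fg_gen x) by rewrite -(eq_visited cg).
exists (Sub (coset_vertex g, x) vE); split=> //=.
by rewrite /coset_vertex (eq_coset_rep cg).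
Qed.

Lemma schreier_dart g l : visited g -> visited (g * fg_of [:: l]) ->
  exists d : letter (edge schreier), [/\ dsrc d = coset_vertex g,
    dtgt d = coset_vertex (g * fg_of [:: l]) & dlab d = l].
Proof.
case: l => x []; rewrite fg_of1 /= => vg vgx.
  have [e [se te le]] := schreier_step vg vgx; exists (e, true); rewrite -{2}le.
  split=> //.
have [|e [se te le]] := @schreier_step _ x vgx; first by rewrite mulgVK.
exists (e, false); rewrite -{2}le; split=> //.
by change (tgt e = coset_vertex g); rewrite te mulgVK.
Qed.

Lemma schreier_prefix s k : s \in S -> k <= size (word s) ->
  exists2 p, walk (base schreier) p (coset_vertex (fg_of (take k (word s)))) &
    map (@dlab _ _) p = take k (word s).
Proof.
move=> sS; have vis j : j <= size (word s) -> visited (fg_of (take j (word s))).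
  move=> js; apply: visited_prefix; rewrite inE; apply/orP; right.
  by apply/allpairsPdep; exists s, j; rewrite mem_iota ltnS.
elim: k => [|k IH] ks.
  by exists [::]; rewrite ?take0 //= fg_of_nil eqxx.
have [l takeS] : exists l, take k.+1 (word s) = rcons (take k (word s)) l.
  case: (word s) ks => // l0 w ks; exists (nth l0 (l0 :: w) k).
  exact: take_nth.
have [p wp pl] := IH (ltnW ks).
have := vis _ ks; rewrite takeS -cats1 fg_of_cat => vS.
have [d [sd td dl]] := schreier_dart (vis _ (ltnW ks)) vS.
exists (p ++ [:: d]); last by rewrite map_cat pl /= dl.
by apply: walk_cat wp _; rewrite /= sd td !eqxx.
Qed.

Lemma schreier_connected : connected schreier.
Proof.
move=> v; have vv : visited (val v) by apply: reps_visited; exact: valP.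
have /hasP[g gP vg] := vv.
have -> : v = coset_vertex g.
  apply: coseq_vertex; apply: coseq_trans vg _; apply: coset_vertexP.
  exact: visited_prefix.
move: gP; rewrite inE => /orP[/eqP->|]; first by exists [::] => /=.
move=> /allpairsPdep[s [k [sS]]]; rewrite mem_iota ltnS => ks ->.
by have [p wp _] := schreier_prefix sS ks; exists p.
Qed.

Lemma schreier_lang g : lang schreier g <-> K g.
Proof.
apply: (lang_potential Ksub KS schreier_potential) => [|s sS].
  by apply/coseq1/coseq_sym/coset_vertexP/visited_prefix/mem_head.
have [p wp pl] := schreier_prefix sS (leqnn _); exists p; last first.
  by rewrite pl take_size fg_of_word.
move: wp; rewrite take_size fg_of_word; congr walk.
apply: coseq_vertex; have vs : visited s.
  apply: visited_prefix; rewrite inE; apply/orP; right; apply/allpairsPdep.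
  by exists s, (size (word s)); rewrite mem_iota ltnS leqnn take_size fg_of_word.
apply: coseq_trans (coseq_sym (coset_vertexP vs)) _.
apply: coseq_trans (coset_vertexP (visited_prefix (mem_head 1 _))).
by apply/coseq1/KS => L _; apply.
Qed.
End Schreier.

(** The second subgroup only has to be read by some finite connected folded graph, which the
    Schreier graph gives without running the folding process. *)
Lemma subgroup_graph (X : finType) (K : freeGroup X -> Prop) :
  is_subgroup K -> finitely_generated K ->
  exists B : lgraph X, [/\ folded B, connected B & forall g, lang B g <-> K g].
Proof.
move=> Ksub [S KS]; exists (schreier S Ksub); split.
- exact: schreier_folded.
- exact: schreier_connected.
- exact: schreier_lang.
Qed.

(** * Stallings foldings *)

Section Folding.
Variables (X : choiceType) (H : freeGroup X -> Prop) (S : seq (freeGroup X)).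
Hypotheses (Hsub : is_subgroup H) (HS : generates S H).

Notation coseq := (coseq H).
Let coseq_sym := coseq_sym Hsub.
Let coseq_trans := coseq_trans Hsub.

(** First invariant of folding: a label-preserving morphism from the rose, onto the vertices. It
    keeps the generators readable and the graph connected. *)
Definition rose_image (A : lgraph X) : Prop :=
  exists (phi : vertex (rose S) -> vertex A) (psi : edge (rose S) -> edge A),
  [/\ forall e, src (psi e) = phi (src e), forall e, tgt (psi e) = phi (tgt e),
      forall e, lab (psi e) = lab e, phi (base (rose S)) = base A &
      forall v, exists w, phi w = v].

(** Second invariant of folding: it bounds the language from above by [H]. *)
Definition has_potential (A : lgraph X) : Prop :=
  exists2 t : vertex A -> freeGroup X, potential H t & H (t (base A)).

Lemma fold_step_image A B : fold_step A B -> rose_image A -> rose_image B.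
Proof.
move=> [e1 [e2 [fV [fE [_ [fs ft fl fb] [fVs _] _ _]]]]] [phi [psi [ps pt pl pb pV]]].
exists (fV \o phi), (fE \o psi); split=> [e|e|e||v] /=.
- by rewrite fs ps.
- by rewrite ft pt.
- by rewrite fl pl.
- by rewrite pb.
by have [a <-] := fVs v; have [w <-] := pV a; exists w.
Qed.

(** Foldable edges share a label and an end, so their other ends carry the same coset too. Thus
    identified vertices have equal cosets, and composing [t] with any section of [fV] gives a
    potential on the quotient. *)
Lemma fold_step_potential A B : fold_step A B -> has_potential A -> has_potential B.
Proof.
move=> [e1 [e2 [fV [fE [[_ le st] [fs ft fl fb] [fVs fEs] _ fVe]]]]] [t tP tb].
have tE e : coseq (t (src e) * fg_gen (lab e)) (t (tgt e)) by exact/decideP.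
have [ts tt] : coseq (t (src e1)) (t (src e2)) /\ coseq (t (tgt e1)) (t (tgt e2)).
  case: st => E; split; rewrite ?E ?coseq_refl //.
    by apply: coseq_trans (coseq_sym (tE e1)) _; rewrite E le.
  apply: coseqMr (coseq_trans (tE e1) _); rewrite E -?le; apply: coseq_sym.
  by rewrite le.
have glueP x y v v' : coseq (t x) (t y) -> glue x y v v' -> coseq (t v) (t v').
  by move=> xy [->|[-> ->]|[-> ->]] //; [exact: coseq_refl | exact: coseq_sym].
have tf v v' : fV v = fV v' -> coseq (t v) (t v').
  by move=> /fVe[]; exact: glueP.
have [s sP] := fin_all_exists fVs.
have ts' v : coseq (t (s (fV v))) (t v) by apply: tf; rewrite sP.
exists (t \o s) => [e|] /=.
  have [a <-] := fEs e; rewrite fs ft fl; apply/decideP.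
  apply: coseq_trans (coseqM _ (ts' _)) _.
  by apply: coseq_trans (tE a) (coseq_sym (ts' _)).
have [_ HM _] := Hsub; have /decideP h := ts' (base A).
by rewrite -fb; have := HM _ _ h tb; rewrite mulgVK.
Qed.

Lemma rose_pointP (i : 'I_(size S)) (k : 'I_(size (petal i)).-1) :
  rose_point i k.+1 = Some (Tagged (fun i => 'I_(size (petal i)).-1) k).
Proof. by rewrite /rose_point valK. Qed.

Lemma rose_point_end (i : 'I_(size S)) k : size (petal i) <= k -> rose_point i k = None.
Proof.
by case: k => //= k sk; rewrite /rose_point insubF //; apply/negbTE; lia.
Qed.

Lemma rose_potential : has_potential (rose S).
Proof.
(* A petal point gets the prefix read so far. Closing a petal at the base is consistent because the
   whole word lies in [H]. *)
pose t (v : vertex (rose S)) : freeGroup X :=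
  if v is Some j then fg_of (take (tagged j).+1 (petal (tag j))) else 1.
have [H1 _ _] := Hsub.
have petalH (i : 'I_(size S)) : H (fg_of (petal i)).
  by rewrite fg_of_word; apply/HS => L _; apply; exact: (mem_tnth i (in_tuple S)).
have tP (i : 'I_(size S)) k : k <= size (petal i) ->
    coseq (t (rose_point i k)) (fg_of (take k (petal i))).
  case: k => [|k] ks; first by rewrite take0 fg_of_nil coseq_refl.
  rewrite /rose_point; case: insubP => [j _ <-|]; first exact: coseq_refl.
  rewrite -leqNgt => sk; have -> : k.+1 = size (petal i) by lia.
  by rewrite take_size; apply/coseq_sym/coseq1.
exists t => // e; apply/decideP; rewrite /= /rose_src /rose_tgt.
case: e => i k /=; rewrite /rose_letter /=.
(* The letter [l0] serves only as a default for [nth]. *)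
have [l0 _] : {l | l = tnth (in_tuple (petal i)) k} by eexists.
have := tP i k (ltnW (ltn_ord k)); have := tP i k.+1 (ltn_ord k).
rewrite (take_nth l0) // -cats1 fg_of_cat (tnth_nth l0) fg_of1 /=.
set l := nth _ _ _; set u := fg_of _; case: l.2 => c2 c1.
  by apply: coseq_trans (coseqM _ c1) (coseq_sym c2).
apply: coseq_trans (coseqM _ c2) _; rewrite mulgVK; exact: coseq_sym.
Qed.

Lemma rose_image_rose : rose_image (rose S).
Proof. by exists id, id; split=> // v; exists v. Qed.

Section Image.
Variable A : lgraph X.
Hypothesis SA : rose_image A.

Lemma rose_image_darts : exists (phi : rose_vertex S -> vertex A)
    (d : forall i : 'I_(size S), 'I_(size (petal i)) -> letter (edge A)),
  [/\ phi None = base A, forall v, exists w, phi w = v,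
      forall i k, dsrc (d i k) = phi (rose_point i k),
      forall i k, dtgt (d i k) = phi (rose_point i k.+1) &
      forall i k, dlab (d i k) = tnth (in_tuple (petal i)) k].
Proof.
have [phi [psi [ps pt pl pb pV]]] := SA.
exists phi, (fun i k => let e := Tagged (fun i => 'I_(size (petal i))) k in
  (psi e, (rose_letter e).2)); split=> // i k.
- by rewrite /dsrc /= ps pt /= /rose_src /rose_tgt; case: (rose_letter _).2.
- by rewrite /dtgt /= ps pt /= /rose_src /rose_tgt; case: (rose_letter _).2.
- by rewrite /dlab /= pl /= -surjective_pairing.
Qed.

Lemma petal_walk : exists2 phi : rose_vertex S -> vertex A,
  phi None = base A /\ (forall v, exists w, phi w = v) &
  forall i k, k <= size (petal i) ->
    exists2 p, walk (base A) p (phi (rose_point i k)) & map (@dlab _ _) p = take k (petal i).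
Proof.
have [phi [d [pb pV ds dt dl]]] := rose_image_darts.
exists phi => // i; elim=> [|k IH] ks; first by exists [::]; rewrite ?take0 //= -pb.
have [p wp pl] := IH (ltnW ks); pose o := Ordinal ks.
exists (p ++ [:: d i o]).
  by apply: walk_cat wp _; rewrite /= ds dt !eqxx.
have [l0 _] : {l | l = tnth (in_tuple (petal i)) o} by eexists.
by rewrite map_cat pl /= dl (tnth_nth l0) cats1 /= -take_nth.
Qed.

Lemma rose_image_connected : connected A.
Proof.
have [phi [pb pV] pw] := petal_walk => v; have [[[i k]|] <-] := pV v.
  by rewrite -rose_pointP; have [|p] := pw i k.+1; [have := ltn_ord k; lia | exists p].
by exists [::]; rewrite /= pb.
Qed.

Lemma rose_image_lang g : has_potential A -> lang A g <-> H g.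
Proof.
have [phi [pb _] pw] := petal_walk; move=> [t tP tb].
apply: (lang_potential Hsub HS tP tb) => s sS.
have /tnthP[i ->] : s \in in_tuple S by [].
have [p wp pl] := pw i _ (leqnn _); exists p; last by rewrite pl take_size fg_of_word.
by move: wp; rewrite rose_point_end // pb.
Qed.

(* The two edges of a petal at an interior point read consecutive letters of a
   reduced word, so they stay distinct after folding. *)
Lemma rose_image_two_darts (v : vertex A) : v <> base A ->
  exists d d' : letter (edge A), [/\ d <> d', dsrc d = v & dsrc d' = v].
Proof.
have [phi [d [pb pV ds dt dl]]] := rose_image_darts.
have [[[i k]|] <-] := pV v => //= _.
have k1 : k < size (petal i) by have := ltn_ord k; lia.
have k2 : k.+1 < size (petal i) by have := ltn_ord k; lia.
exists (linv (d i (Ordinal k1))), (d i (Ordinal k2)).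
split=> [E||]; last 2 first.
- by rewrite dsrc_linv dt -rose_pointP.
- by rewrite ds -rose_pointP.
have [l0 _] : {l | l = tnth (in_tuple (petal i)) (Ordinal k1)} by eexists.
have := word_reduced (tnth (in_tuple S) i); rewrite -/(petal i) /reduced.
move=> /(sortedP l0)/(_ k k2); have := dl i (Ordinal k2); rewrite -E dlab_linv dl.
by rewrite !(tnth_nth l0) /= => ->; rewrite eqxx.
Qed.
End Image.
End Folding.

Lemma foldingP (X : choiceType) (H : freeGroup X -> Prop) (A : lgraph X) :
  is_subgroup H -> is_folding H A ->
  [/\ folded A, connected A, forall g, lang A g <-> H g &
      forall v, v <> base A ->
        exists d d' : letter (edge A), [/\ d <> d', dsrc d = v & dsrc d' = v]].
Proof.
move=> Hsub [S [HS SA Af]].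
have SAi B C : clos_refl_trans (lgraph X) (@fold_step X) B C ->
    rose_image S B -> rose_image S C.
  by elim=> // {}B {}C; [exact: fold_step_image | move=> D _ IH1 _ IH2 /IH1/IH2].
have SAp B C : clos_refl_trans (lgraph X) (@fold_step X) B C ->
    has_potential H B -> has_potential H C.
  by elim=> // {}B {}C; [exact: fold_step_potential | move=> D _ IH1 _ IH2 /IH1/IH2].
have Ai := SAi _ _ SA (rose_image_rose S); have Ap := SAp _ _ SA (rose_potential Hsub HS).
split=> //.
- exact: rose_image_connected Ai.
- by move=> g; exact: (rose_image_lang Hsub HS).
- exact: (rose_image_two_darts Ai).
Qed.

(** * Conclusion *)

Section Degrees.
Variables (X : finType) (A : lgraph X).
Hypothesis Afold : folded A.

Lemma outdeg_leq (v : vertex A) : outdeg v <= #|X|.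
Proof.
rewrite /outdeg -(card_in_imset (f := @lab X A)) ?max_card // => e e'.
by rewrite !inE => /eqP se /eqP se'; apply: (folded_src Afold); rewrite se.
Qed.

Lemma indeg_leq (v : vertex A) : indeg v <= #|X|.
Proof.
rewrite /indeg -(card_in_imset (f := @lab X A)) ?max_card // => e e'.
by rewrite !inE => /eqP se /eqP se'; apply: (folded_tgt Afold); rewrite se.
Qed.

Lemma outdeg0_dart (d : letter (edge A)) : outdeg (dsrc d) = 0 -> d.2 = false.
Proof.
case: d => e [] //= /eqP; rewrite cards_eq0 => /eqP/setP/(_ e).
by rewrite !inE eqxx.
Qed.

Lemma indeg0_dart (d : letter (edge A)) : indeg (dsrc d) = 0 -> d.2 = true.
Proof.
case: d => e [] //= /eqP; rewrite cards_eq0 => /eqP/setP/(_ e).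
by rewrite !inE eqxx.
Qed.

Lemma two_darts_indeg (d d' : letter (edge A)) : d <> d' -> dsrc d = dsrc d' ->
  outdeg (dsrc d) = 0 -> 1 < indeg (dsrc d).
Proof.
move=> ne ss od; have := outdeg0_dart od; rewrite ss in od; have := outdeg0_dart od.
case: d d' ne ss {od} => e b [e' b'] /= + + bb bb'; rewrite {}bb {}bb' /dsrc /= => ne tt.
rewrite /indeg (cardsD1 e) (cardsD1 e') !inE tt !eqxx /=.
by have [E|] := eqVneq e e'; first by rewrite E in ne.
Qed.

Lemma two_darts_outdeg (d d' : letter (edge A)) : d <> d' -> dsrc d = dsrc d' ->
  indeg (dsrc d) = 0 -> 1 < outdeg (dsrc d).
Proof.
move=> ne ss od; have := indeg0_dart od; rewrite ss in od; have := indeg0_dart od.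
case: d d' ne ss {od} => e b [e' b'] /= + + bb bb'; rewrite {}bb {}bb' /dsrc /= => ne tt.
rewrite /outdeg (cardsD1 e) (cardsD1 e') !inE tt !eqxx /=.
by have [E|] := eqVneq e e'; first by rewrite E in ne.
Qed.
End Degrees.

(** Away from the base there are two distinct directed edges at each vertex, so in-degree or
    out-degree 0 would make it a source or a sink. The base may have one of them zero, which decides
    the alternative; both zero would make [H] trivial. *)
Lemma source_sink_free_graph (X : finType) (H : freeGroup X -> Prop) :
  #|X| = 2 -> is_subgroup H -> nontrivial H -> source_sink_free H ->
  exists A : lgraph X, [/\ folded A, connected A, forall g, lang A g <-> H g &
    (forall v : vertex A, 0 < outdeg v <= 2) \/ (forall v : vertex A, 0 < indeg v <= 2)].
Proof.
move=> X2 Hsub [x Hx x1] [A /(foldingP Hsub)[Af Ac Al A2] ssf].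
exists A; split=> //.
have o2 (v : vertex A) : outdeg v <= 2 by have := outdeg_leq Af v; rewrite X2.
have i2 (v : vertex A) : indeg v <= 2 by have := indeg_leq Af v; rewrite X2.
have onb (v : vertex A) : v <> base A -> 0 < outdeg v.
  move=> /A2[d [d' [ne dv]]]; rewrite -dv lt0n => ss; apply/negP => /eqP od.
  have gt1 := two_darts_indeg ne (esym ss) od; apply: (ssf (dsrc d)).2.
  by rewrite /is_sink /degree od; have := i2 (dsrc d); lia.
have inb (v : vertex A) : v <> base A -> 0 < indeg v.
  move=> /A2[d [d' [ne dv]]]; rewrite -dv lt0n => ss; apply/negP => /eqP od.
  have gt1 := two_darts_outdeg ne (esym ss) od; apply: (ssf (dsrc d)).1.
  by rewrite /is_source /degree od; have := o2 (dsrc d); lia.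
have [ob|ob] := posnP (outdeg (base A)); last first.
  left=> v; rewrite o2 andbT; have [->//|/eqP] := eqVneq v (base A); exact: onb.
have [ib|ib] := posnP (indeg (base A)); last first.
  right=> v; rewrite i2 andbT; have [->//|/eqP] := eqVneq v (base A); exact: inb.
case: x1; have [[|d p] /=] := (Al x).2 Hx; first by rewrite fg_of_nil.
move=> /andP[/eqP db _]; rewrite -db in ob ib.
by have := outdeg0_dart ob; rewrite (indeg0_dart ib).
Qed.

Lemma eq_has_rank (G : groupType) (H K : G -> Prop) n :
  (forall x, H x <-> K x) -> has_rank H n -> has_rank K n.
Proof. by move=> HK [g [gI gH]]; exists g; split=> // x; rewrite -HK. Qed.

Lemma has_rank_gt0 (G : groupType) (H : G -> Prop) n :
  nontrivial H -> has_rank H n -> 0 < n.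
Proof.
move=> [x Hx x1] [g [_ gH]]; case: n g gH => // g gH; case: x1.
have [u ->] := (gH x).1 Hx; rewrite /free_lift.
by case: (word u) => [|[[]]] //; rewrite big_nil.
Qed.

Lemma rank_pullback (X : choiceType) (A B : lgraph X) :
  folded A -> folded B -> connected B -> #|vertex B| <= #|edge B| ->
  (forall v : vertex A, 0 < outdeg v <= 2) \/ (forall v : vertex A, 0 < indeg v <= 2) ->
  exists2 r, has_rank (subgroupI (lang A) (lang B)) r &
    r <= (#|edge A| - #|vertex A|) * (#|edge B| - #|vertex B|) + 1.
Proof.
move=> Af Bf Bc BVE deg; pose P := pullback A B.
have Pf : folded P by exact: pullback_folded.
have [VE rk] := lang_rank (component_folded Pf) (@component_connected _ P).
exists (#|edge (component_graph P)|.+1 - #|vertex (component_graph P)|).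
  apply: eq_has_rank rk => g; rewrite component_lang; exact: pullback_lang.
have bound : #|[set e : edge P | src e \in component P]| <=
    #|component P| + (#|edge A| - #|vertex A|) * (#|edge B| - #|vertex B|).
  case: deg => deg.
    rewrite (edges_outdeg deg) addKn.
    exact: pullback_bound (@component_edge _ P).
  rewrite (edges_indeg deg) addKn.
  exact: pullback_bound_rev (@component_edge _ P).
by move: bound VE; rewrite card_component_edges card_component_vertices -/P; lia.
Qed.

Lemma hanna_neumann_source_sink_free (X : finType) (H K : freeGroup X -> Prop) (rH rK : nat) :
  #|X| = 2 -> is_subgroup H -> is_subgroup K -> finitely_generated K ->
  nontrivial H -> nontrivial K -> has_rank H rH -> has_rank K rK ->
  source_sink_free H ->
  exists2 r, has_rank (subgroupI H K) r & r <= rH.-1 * rK.-1 + 1.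
Proof.
move=> X2 Hsub Ksub Kfg Hnt Knt HrH KrK Hssf.
have [A [Af Ac Al deg]] := source_sink_free_graph X2 Hsub Hnt Hssf.
have [B [Bf Bc Bl]] := subgroup_graph Ksub Kfg.
have [_ /(eq_has_rank Al)/(has_rank_uniq HrH) rHE] := lang_rank Af Ac.
have [_ /(eq_has_rank Bl)/(has_rank_uniq KrK) rKE] := lang_rank Bf Bc.
have rK0 := has_rank_gt0 Knt KrK.
(* Positive rank of [K] means that [B] is not a tree, that is, it has at least as many edges as
   vertices. *)
have [|r rP rB] := rank_pullback Af Bf Bc _ deg; first by lia.
exists r; first by apply: eq_has_rank rP => g; rewrite /subgroupI Al Bl.
by apply: leq_trans rB _; rewrite leq_add2r leq_mul //; lia.
Qed.

Theorem theorem4p2 (H K : freeGroup 'I_2 -> Prop) (rH rK : nat)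
  (Hsub : is_subgroup H) (Ksub : is_subgroup K)
  (Hfg : finitely_generated H) (Kfg : finitely_generated K)
  (Hnt : nontrivial H) (Knt : nontrivial K)
  (HrH : has_rank H rH) (KrK : has_rank K rK)
  (Hssf : source_sink_free H \/ source_sink_free K) :
  exists2 r : nat, has_rank (subgroupI H K) r &
    (r%:Z - 1 <= (rH%:Z - 1) * (rK%:Z - 1))%R.
Proof.
have [r rP rB] : exists2 r, has_rank (subgroupI H K) r & r <= rH.-1 * rK.-1 + 1.
  case: Hssf => [Hssf|Kssf]; first by apply: hanna_neumann_source_sink_free; rewrite ?card_ord.
  have [|r rP rB] := hanna_neumann_source_sink_free _ Ksub Hsub Hfg Knt Hnt KrK HrH Kssf.
    by rewrite card_ord.
  exists r; last by rewrite mulnC.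
  by apply: eq_has_rank rP => x; split=> -[].
(* Both ranks are positive, so the truncated predecessors agree with the integer differences. *)
exists r => //; have rH0 := has_rank_gt0 Hnt HrH; have rK0 := has_rank_gt0 Knt KrK.
by case: rH rK rH0 rK0 rB {HrH KrK} => // a [] // b _ _ /=; nia.
Qed.
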